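(* For every integer $n\geq 9$ there exists a spherical congruence-uniform lattice with exactly $n$ elements whose core label order is not a lattice.
   Context: All lattices are finite. For a finite lattice $\mathcal{L}=(L,\leq)$, $\mathcal{J}(\mathcal{L})$ denotes the set of join-irreducible elements; each $j\in\mathcal{J}(\mathcal{L})$ has a unique lower cover $j_*$. For a cover relation $u\lessdot v$, $\mathrm{cg}(u,v)$ is the finest lattice congruence in which $u,v$ are equivalent, and $\mathrm{cg}(j)=\mathrm{cg}(j_*,j)$; the join-irreducible elements of the congruence lattice are exactly the $\mathrm{cg}(j)$. A finite lattice is congruence-uniform if $j\mapsto\mathrm{cg}(j)$ is a bijection from $\mathcal{J}(\mathcal{L})$ onto the join-irreducible congruences, for both $\mathcal{L}$ and its dual. For a cover $u\lessdot v$ in a congruence-uniform lattice, $j_{\mathrm{cg}(u,v)}$ denotes the unique $j\in\mathcal{J}(\mathcal{L})$ with $\mathrm{cg}(j)=\mathrm{cg}(u,v)$. The nucleus of $x$ is $x_\downarrow=\bigwedge\{y\mid y\lessdot x\}$; the core label set is $\Psi(x)=\{j_{\mathrm{cg}(u,v)}\mid x_\downarrow\le u\lessdot v\le x\}$ (empty for $x=\hat0$). The core label order of $\mathcal{L}$ is $(L,\sqsubseteq)$ with $x\sqsubseteq y$ iff $\Psi(x)\subseteq\Psi(y)$. A bounded poset is spherical if the order complex of its proper part (with $\hat0,\hat1$ removed) is homotopy equivalent to a sphere. *)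

(* Defs.v *)
From HB Require Import structures.
From mathcomp Require Import all_boot all_order all_algebra.

Set Implicit Arguments.
Unset Strict Implicit.
Unset Printing Implicit Defensive.

Import Order.TTheory.

Local Open Scope order_scope.

Section Covers.
Variables (d : Order.disp_t) (L : finTBLatticeType d).
Implicit Types u v x j : L.

Definition covby u v := (u < v) && ~~ [exists w : L, (u < w) && (w < v)].

Definition join_irreducible j :=
  (j != \bot) &&
  [forall x : L, forall y : L, (j == x `|` y) ==> ((j == x) || (j == y))].

Definition join_irreducibles : {set L} := [set j | join_irreducible j].

(* the lower cover of [j]; only meaningful when it is unique, in particular
   for join-irreducible [j] *)
Definition lower_cover j : L := odflt j [pick y | covby y j].

(* the empty meet is [\top], so [nucleus \bot = \top] *)
Definition nucleus x : L := \meet_(y : L | covby y x) y.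

Lemma lower_cover_unique j y :
  join_irreducible j -> covby y j = (y == lower_cover j).
Proof.
have below x : x < j -> exists2 z : L, x <= z & covby z j.
  have [n] := ubnP #|[set w : L | x < w]|; elim: n x => // n IH x ltn xj.
  have [/existsP[w /andP[xw wj]]|Nw] :=
    boolP [exists w : L, (x < w) && (w < j)].
    have [|//|z wz zj] := IH w; last first.
      by exists z => //; exact: le_trans (ltW xw) wz.
    apply: leq_trans _ (ltn : _ <= n)%N; apply: proper_card.
    apply/properP; split.
      by apply/subsetP=> z; rewrite !inE; exact: lt_trans.
    by exists w; rewrite !inE // ltxx.
  by exists x => //; rewrite /covby xj.
move=> /andP[j0 /forallP jP]; rewrite /lower_cover.
case: pickP => [z jz|Nz] /=; last first.
  have [|z _] := below \bot; first by rewrite lt0x.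
  by rewrite Nz.
apply/idP/eqP => [jy|->//]; apply/eqP/negPn/negP => yz.
have [yj zj] : y < j /\ z < j by case/andP: jy; case/andP: jz.
have := jP y => /forallP/(_ z)/implyP; rewrite [j == y]gt_eqF // [j == z]gt_eqF //.
suff jU : j == y `|` z by move/(_ jU).
rewrite eq_le leUx (ltW yj) (ltW zj) !andbT.
case/andP: jy => _ /existsPn /(_ (y `|` z)); rewrite negb_and.
have yU : y < y `|` z.
  rewrite lt_def leUl andbT; apply/negP => /eqP Uy.
  have zy : z < y by rewrite lt_def yz -Uy leUr.
  by case/andP: jz => _ /existsPn /(_ y); rewrite zy yj.
rewrite yU /= => /negP Uj; apply/negPn/negP => NjU; apply: Uj.
rewrite lt_def leUx (ltW yj) (ltW zj) !andbT.
by apply/negP => /eqP E; move: NjU; rewrite -E lexx.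
Qed.

End Covers.

Section Congruences.
Variables (d : Order.disp_t) (L : finTBLatticeType d).

Definition is_congruence (E : {set L * L}) :=
  [&& [forall x : L, (x, x) \in E],
      [forall x : L, forall y : L, ((x, y) \in E) ==> ((y, x) \in E)],
      [forall x : L, forall y : L, forall z : L,
        ((x, y) \in E) && ((y, z) \in E) ==> ((x, z) \in E)],
      [forall x : L, forall y : L, forall x' : L, forall y' : L,
        ((x, y) \in E) && ((x', y') \in E) ==> ((x `|` x', y `|` y') \in E)]
    & [forall x : L, forall y : L, forall x' : L, forall y' : L,
        ((x, y) \in E) && ((x', y') \in E) ==> ((x `&` x', y `&` y') \in E)]].

Record congr := Congr { congr_val :> {set L * L}; _ : is_congruence congr_val }.

HB.instance Definition _ := [isSub for congr_val].
HB.instance Definition _ := [Finite of congr by <:].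

Definition generated (S : {set L * L}) : {set L * L} :=
  [set p | [forall E : congr, (S \subset congr_val E) ==> (p \in congr_val E)]].

Lemma generated_congruence S : is_congruence (generated S).
Proof.
have genP p : reflect (forall E : congr, S \subset congr_val E ->
    p \in congr_val E) (p \in generated S).
  by rewrite inE; exact: 'forall_implyP.
apply/and5P; split.
- by apply/forallP => x; apply/genP => -[E /= /[dup] cE /and5P[/forallP]].
- apply/'forall_'forall_implyP => x y /genP xy; apply/genP => E SE.
  case: E SE (xy E SE) => E /= /and5P[_ /'forall_'forall_implyP sE _ _ _] _.
  exact: sE.
- apply/'forall_'forall_'forall_implyP => x y z /andP[/genP xy /genP yz].
  apply/genP => E SE.
  case: E SE (xy E SE) (yz E SE) => E /=.
  move=> /and5P[_ _ /'forall_'forall_'forall_implyP tE _ _] _ Exy Eyz.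
  by apply: (tE x y z); rewrite Exy.
- apply/'forall_'forall_'forall_'forall_implyP => x y x' y'.
  move=> /andP[/genP xy /genP xy']; apply/genP => E SE.
  case: E SE (xy E SE) (xy' E SE) => E /=.
  move=> /and5P[_ _ _ /'forall_'forall_'forall_'forall_implyP jE _] _ E1 E2.
  by apply: jE; rewrite E1.
- apply/'forall_'forall_'forall_'forall_implyP => x y x' y'.
  move=> /andP[/genP xy /genP xy']; apply/genP => E SE.
  case: E SE (xy E SE) (xy' E SE) => E /=.
  move=> /and5P[_ _ _ _ /'forall_'forall_'forall_'forall_implyP mE] _ E1 E2.
  by apply: mE; rewrite E1.
Qed.

(* the finest congruence containing [S] *)
Definition congr_gen S : congr := Congr (generated_congruence S).

Definition congr_le (E F : congr) := congr_val E \subset congr_val F.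

Fact congr_le_refl : reflexive congr_le.
Proof. by move=> E; exact: subxx. Qed.

Fact congr_le_anti : antisymmetric congr_le.
Proof. by move=> E F EF; apply: val_inj; apply/eqP; rewrite eqEsubset. Qed.

Fact congr_le_trans : transitive congr_le.
Proof. by move=> F E G; exact: subset_trans. Qed.

Fact congr_display : Order.disp_t. Proof. exact: Order.Disp tt tt. Qed.

HB.instance Definition _ := Order.Le_isPOrder.Build congr_display congr
  congr_le_refl congr_le_anti congr_le_trans.

Lemma leEcongr (E F : congr) : (E <= F) = (congr_val E \subset congr_val F).
Proof. by []. Qed.

Lemma congr_gen_le (S : {set L * L}) (E : congr) :
  (congr_gen S <= E) = (S \subset congr_val E).
Proof.
rewrite leEcongr; apply/idP/idP => [|SE].
  apply: subset_trans; apply/subsetP => p Sp; rewrite inE.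
  by apply/forallP => F; apply/implyP => /subsetP; apply.
by apply/subsetP => p; rewrite inE => /forallP /(_ E); rewrite SE.
Qed.

Lemma sub_congr_gen (S : {set L * L}) : S \subset congr_val (congr_gen S).
Proof. by rewrite -congr_gen_le. Qed.

Definition congr_meet (E F : congr) := congr_gen (congr_val E :&: congr_val F).
Definition congr_join (E F : congr) := congr_gen (congr_val E :|: congr_val F).

Fact congr_meetP (E F G : congr) :
  (E <= congr_meet F G) = (E <= F) && (E <= G).
Proof.
apply/idP/idP => [EFG|/andP[EF EG]].
  by apply/andP; split; apply: le_trans EFG _;
    rewrite congr_gen_le ?subsetIl ?subsetIr.
apply: subset_trans (sub_congr_gen _).
by rewrite subsetI; apply/andP.
Qed.

Fact congr_joinP (E F G : congr) :
  (congr_join E F <= G) = (E <= G) && (F <= G).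
Proof. by rewrite congr_gen_le subUset. Qed.

HB.instance Definition _ := Order.POrder_MeetJoin_isLattice.Build
  congr_display congr congr_meetP congr_joinP.

Fact congr_le0 (E : congr) : congr_gen set0 <= E.
Proof. by rewrite congr_gen_le sub0set. Qed.

Fact congr_le1 (E : congr) : E <= congr_gen [set: L * L].
Proof. exact: subset_trans (subsetT _) (sub_congr_gen _). Qed.

HB.instance Definition _ := Order.hasBottom.Build congr_display congr congr_le0.
HB.instance Definition _ := Order.hasTop.Build congr_display congr congr_le1.

Definition cg (u v : L) : congr := congr_gen [set (u, v)].

Definition cgj (j : L) : congr := cg (lower_cover j) j.

End Congruences.

Definition cgj_bijective (d : Order.disp_t) (L : finTBLatticeType d) :=
  {in join_irreducibles L &, injective (@cgj d L)} /\
  [set cgj j | j in join_irreducibles L] = join_irreducibles (congr L).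

Definition congruence_uniform (d : Order.disp_t) (L : finTBLatticeType d) :=
  cgj_bijective L /\ cgj_bijective L^d.

Section CoreLabelOrder.
Variables (d : Order.disp_t) (L : finTBLatticeType d).

(* j_{cg(u,v)}; only meaningful when the join-irreducible it picks is unique *)
Definition j_cg (u v : L) : L :=
  odflt \bot [pick j in join_irreducibles L | cgj j == cg u v].

Definition core_label_set (x : L) : {set L} :=
  [set j_cg p.1 p.2 | p : L * L
     & [&& nucleus x <= p.1, covby p.1 p.2 & p.2 <= x]].

Definition core_label_order : rel L :=
  fun x y => core_label_set x \subset core_label_set y.

End CoreLabelOrder.

(* Every pair has a meet and a join with respect to [r].  Being a partial order
   is deliberately not part of this definition, so that [~ is_lattice r] can only
   hold because some meet or join is missing. *)
Definition is_lattice (T : Type) (r : rel T) :=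
  forall x y : T,
    (exists m, [/\ r m x, r m y & forall z, r z x -> r z y -> r z m]) /\
    (exists j, [/\ r x j, r y j & forall z, r x z -> r y z -> r j z]).

Definition proper_part (d : Order.disp_t) (L : finTBLatticeType d) : {set L} :=
  [set x | (x != \bot) && (x != \top)].

(* the empty chain is included as the empty face *)
Definition order_complex (d : Order.disp_t) (L : finTBLatticeType d) :
    {set {set L}} :=
  [set C : {set L} | (C \subset proper_part L) &&
     [forall x in C, forall y in C, x >=< y]].

From mathcomp Require Import all_classical all_reals topology normedtype.
Import GRing.Theory Num.Theory numFieldNormedType.Exports.

Local Open Scope classical_set_scope.
Local Open Scope ring_scope.

(* barycentric coordinates: points of the standard simplex on [V] whose
   support is a face of [K], with the topology induced from R^V *)
Definition realization (R : realType) (V : finType) (K : {set {set V}}) :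
    set (prod_topology (fun _ : V => R)) :=
  [set x | [/\ forall v, 0 <= x v,
               \sum_(v : V) x v = 1
             & [set v | x v != 0]%SET \in K]].
Arguments realization R {V} K.

(* the sphere S^(k-1) in R^k; it is empty for k = 0 *)
Definition unit_sphere (R : realType) (k : nat) : set 'rV[R]_k :=
  [set x : 'rV[R]_k | \sum_(i < k) x ord0 i ^+ 2 = 1].
Arguments unit_sphere R k : clear implicits.

Definition homotopic (R : realType) (X Y : topologicalType) (f g : X -> Y) :=
  exists H : R * X -> Y,
    [/\ {within `[0, 1]%classic `*` [set: X], continuous H},
        forall x, H (0, x) = f x
      & forall x, H (1, x) = g x].

Definition homotopy_equivalent (R : realType) (X Y : topologicalType) :=
  exists (f : X -> Y) (g : Y -> X),
    [/\ continuous f, continuous g,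
        homotopic R (g \o f) idfun & homotopic R (f \o g) idfun].

Definition spherical (R : realType) (d : Order.disp_t)
    (L : finTBLatticeType d) :=
  exists k : nat,
    homotopy_equivalent R (set_type (realization R (order_complex L)))
                          (set_type (unit_sphere R k)).

(* Main.v *)
Require Import Defs.
From HB Require Import structures.
From mathcomp Require Import all_boot all_order all_algebra.
From mathcomp Require Import all_classical all_reals topology.
From mathcomp Require Import normedtype realfun.
From mathcomp Require Import zify ring lra.

(* Stretch one atom of the Boolean lattice on the atoms a, b, c to a chain
   a_1 < ... < a_m with m >= 2.  This has m + 7 elements.  The congruences given
   by membership of b, of c, of some a_i, and by collapsing a single pair
   a_(i-1), a_i with i >= 2, separate the labels of all join-irreducible and all
   meet-irreducible elements, so the lattice is congruence-uniform.  The nucleus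
   of both ab and ac is the bottom, so both have all the a_i as core labels, and
   besides these only b, respectively c.  An element whose core labels are
   common to ab and ac lies below a_m and has at most one core label, hence
   ab and ac have no meet in the core label order.  The order complex of the
   proper part is a hexagon in which the vertex a and its two edges are
   thickened; pushing the weight of every a_i to a_m retracts it to the
   hexagon, and radial projection maps the hexagon to the circle. *)

Set Implicit Arguments.
Unset Strict Implicit.
Unset Printing Implicit Defensive.

Import Order.TTheory GRing.Theory Num.Theory numFieldNormedType.Exports.

(** * Join-irreducible elements and congruences of a finite lattice *)

Section LatticeTheory.
Local Open Scope order_scope.

Lemma join_irreducible_bigjoin (d : Order.disp_t) (L : finTBLatticeType d)
    (I : finType) (P : pred I) (F : I -> L) (j : L) :
  join_irreducible j -> j = \join_(i | P i) F i -> exists2 i, P i & j = F i.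
Proof.
case/andP=> j0 /'forall_'forall_implyP jU.
elim/big_rec: _ => [/eqP|i x Pi IH /eqP /jU /orP[]/eqP //].
  by rewrite (negPf j0).
by exists i.
Qed.

Section CongruenceTheory.
Variables (d : Order.disp_t) (L : finTBLatticeType d).
Implicit Types (x y z u v j : L) (E F : congr L).

(** Compatibility may be tested by translating with one element at a time: transitivity joins two
    such moves into the two-sided condition. *)
Lemma is_congruenceP (S : {set L * L}) :
  reflect [/\ forall x, (x, x) \in S,
              forall x y, (x, y) \in S -> (y, x) \in S,
              forall x y z, (x, y) \in S -> (y, z) \in S -> (x, z) \in S,
              forall x y z, (x, y) \in S -> (x `|` z, y `|` z) \in S
            & forall x y z, (x, y) \in S -> (x `&` z, y `&` z) \in S]
          (is_congruence S).
Proof.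
apply: (iffP and5P) => -[rS sS tS jS mS].
  have {}rS := forallP rS.
  have {}jS := elimT 'forall_'forall_'forall_'forall_implyP jS.
  have {}mS := elimT 'forall_'forall_'forall_'forall_implyP mS.
  split=> //.
  - by move=> x y Sxy; apply: (implyP (forallP (forallP sS x) y)).
  - move=> x y z Sxy Syz.
    by apply: (implyP (forallP (forallP (forallP tS x) y) z)); rewrite Sxy.
  - by move=> x y z Sxy; apply: jS; rewrite Sxy rS.
  - by move=> x y z Sxy; apply: mS; rewrite Sxy rS.
split.
- exact/forallP.
- by apply/'forall_'forall_implyP => x y; apply: sS.
- by apply/'forall_'forall_'forall_implyP => x y z /andP[]; apply: tS.
- apply/'forall_'forall_'forall_'forall_implyP => x y x' y' /andP[xy xy'].
  by apply: tS (jS _ _ x' xy) _; rewrite ![y `|` _]joinC; apply: jS.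
- apply/'forall_'forall_'forall_'forall_implyP => x y x' y' /andP[xy xy'].
  by apply: tS (mS _ _ x' xy) _; rewrite ![y `&` _]meetC; apply: mS.
Qed.

Lemma congr_axioms E :
  [/\ forall x, (x, x) \in congr_val E,
      forall x y, (x, y) \in congr_val E -> (y, x) \in congr_val E,
      forall x y z, (x, y) \in congr_val E -> (y, z) \in congr_val E ->
        (x, z) \in congr_val E,
      forall x y z, (x, y) \in congr_val E ->
        (x `|` z, y `|` z) \in congr_val E
    & forall x y z, (x, y) \in congr_val E ->
        (x `&` z, y `&` z) \in congr_val E].
Proof. by apply/is_congruenceP; case: E. Qed.

Lemma kernel_congruence (Z : eqType) (g : L -> Z) :
  (forall x y z, g x = g y -> g (x `|` z) = g (y `|` z)) ->
  (forall x y z, g x = g y -> g (x `&` z) = g (y `&` z)) ->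
  is_congruence [set w : L * L | g w.1 == g w.2].
Proof.
move=> gU gI; apply/is_congruenceP; split=> [x|x y|x y z|x y z|x y z];
  rewrite !inE /= 1?eq_sym //.
- by move=> /eqP -> .
- by move=> /eqP /gU ->.
- by move=> /eqP /gI ->.
Qed.

Lemma cg_le u v E : (cg u v <= E) = ((u, v) \in congr_val E).
Proof. by rewrite congr_gen_le finset.sub1set. Qed.

Lemma mem_cg u v : (u, v) \in congr_val (cg u v).
Proof. by rewrite -cg_le. Qed.

(** This is how labels are told apart: pairs with the same label are collapsed by the same
    congruences. *)
Lemma eq_cg_mem u v u' v' (S : {set L * L}) :
  cg u v = cg u' v' -> is_congruence S -> ((u, v) \in S) = ((u', v') \in S).
Proof.
by move=> eq_uv cS; have := cg_le u v (Congr cS); rewrite eq_uv cg_le.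
Qed.

Let step E F : rel L :=
  fun x y => ((x, y) \in congr_val E) || ((x, y) \in congr_val F).

Lemma step_connect_map E F (f : L -> L) x y :
  (forall z t, step E F z t -> step E F (f z) (f t)) ->
  connect (step E F) x y -> connect (step E F) (f x) (f y).
Proof.
move=> fE /connectP[s sP ->]; elim: s x sP => //= z s IH x /andP[xz zs].
by apply: connect_trans (connect1 (fE _ _ xz)) (IH _ zs).
Qed.

Lemma step_join E F z x y : step E F x y -> step E F (x `|` z) (y `|` z).
Proof.
have [_ _ _ EU _] := congr_axioms E; have [_ _ _ FU _] := congr_axioms F.
by case/orP=> [/EU|/FU] H; apply/orP; [left|right].
Qed.

Lemma step_meet E F z x y : step E F x y -> step E F (x `&` z) (y `&` z).
Proof.
have [_ _ _ _ EI] := congr_axioms E; have [_ _ _ _ FI] := congr_axioms F.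
by case/orP=> [/EI|/FI] H; apply/orP; [left|right].
Qed.

Lemma step_sym E F x y : step E F x y = step E F y x.
Proof.
suff {x y} H x y : step E F x y -> step E F y x by apply/idP/idP; apply: H.
have [_ Es _ _ _] := congr_axioms E; have [_ Fs _ _ _] := congr_axioms F.
by case/orP=> [/Es|/Fs] H; apply/orP; [left|right].
Qed.

(** Being linked by a zigzag of [step]s is itself a congruence containing [E] and [F], so it
    contains their join. *)
Lemma mem_congr_join E F x y :
  (x, y) \in congr_val (congr_join E F) -> connect (step E F) x y.
Proof.
pose S := [set w : L * L | connect (step E F) w.1 w.2].
have cS : is_congruence S.
  apply/is_congruenceP; split=> [z|z t|z t w|z t w|z t w]; rewrite !inE //=.
  - by rewrite (sym_connect_sym (@step_sym E F)).
  - exact: connect_trans.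
  - by apply: (step_connect_map (f := Order.join^~ w)) => ? ?; apply: step_join.
  - by apply: (step_connect_map (f := Order.meet^~ w)) => ? ?; apply: step_meet.
suff : congr_join E F <= Congr cS by move/fintype.subsetP=> H /H; rewrite inE.
rewrite congr_gen_le; apply/fintype.subsetP => -[z t]; rewrite inE => zt.
by rewrite inE; apply: connect1.
Qed.

(* Projecting a zigzag in E and F onto the two-element interval [u, v]
   exhibits a single step that collapses it. *)
Lemma covby_congr_join E F u v : covby u v ->
  (u, v) \in congr_val (congr_join E F) ->
  ((u, v) \in congr_val E) || ((u, v) \in congr_val F).
Proof.
case/andP=> uv /existsPn Nuv /mem_congr_join.
pose f x := (x `|` u) `&` v.
have fu : f u = u by rewrite /f joinxx; apply/meet_idPl/ltW.
have fv : f v = v by rewrite /f; apply/meet_idPr/leUl.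
have f2 x : f x = u \/ f x = v.
  have ufx : u <= f x by rewrite lexI leUr ltW.
  have fxv : f x <= v by rewrite leIr.
  have := Nuv (f x); rewrite !lt_def ufx fxv !andbT negb_and !negbK.
  by case/orP=> /eqP; [left|right].
rewrite -/(step E F u v) => uv_conn; apply/negPn/negP => Nstep.
have cl : fingraph.closed (step E F) [pred x | f x == u].
  apply: (intro_closed (sym_connect_sym (@step_sym E F))) => x y xy.
  rewrite !inE => /eqP fxu; have [/eqP//|fyv] := f2 y.
  by case/negP: Nstep; rewrite -{1}fxu -{1}fyv; apply/step_meet/step_join.
by have := closed_connect cl uv_conn; rewrite !inE fu fv eqxx [v == u]gt_eqF.
Qed.

(** Take [j] minimal among the elements below [y] but not below [x]. Everything strictly below [j]
    is then below [x], which rules out [j] being a join of smaller elements. *)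
Lemma join_irreducible_below x y : x < y ->
  exists j, [/\ join_irreducible j, j <= y, ~~ (j <= x) & lower_cover j <= x].
Proof.
move=> xy; pose P := [pred z | (z <= y) && ~~ (z <= x)].
have Py : P y by rewrite /= lexx lt_geF.
have [j /andP[jy Njx] jmin] := arg_minnP (fun z => #|[set w | w <= z]|) Py.
have jlt z : z < j -> z <= x.
  move=> zj; apply/negPn/negP => Nzx.
  have := jmin z; rewrite /= Nzx (le_trans (ltW zj) jy) => /(_ isT).
  rewrite leqNgt proper_card //; apply/properP; split.
    by apply/fintype.subsetP => w; rewrite !inE => /le_trans -> //; apply: ltW.
  by exists j; rewrite !inE ?lexx ?lt_geF.
have jJ : join_irreducible j.
  apply/andP; split; first by apply: contraNneq Njx => ->; rewrite le0x.
  apply/'forall_'forall_implyP => z t /eqP jE; apply/negPn.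
  rewrite negb_or; apply/negP => /andP[jz jt]; case/negP: Njx.
  by rewrite jE leUx !jlt // lt_neqAle ?[z == _]eq_sym ?[t == _]eq_sym
    ?jz ?jt {1}jE ?leUl ?leUr.
exists j; split=> //; apply: jlt.
by have := lower_cover_unique (lower_cover j) jJ; rewrite eqxx => /andP[].
Qed.

(** If [E] collapses [x < y], choose [j] as in [join_irreducible_below]. Meeting with [j] shows that
    [E] collapses [lower_cover j] and [j]; joining with [x] turns this into a move from [x] up to
    [j] joined with [x], still below [y]. Iterating reaches [y]. *)
Lemma congr_join_generators E :
  E = \join_(j | join_irreducible j && (cgj j <= E)) cgj j.
Proof.
set F := (RHS); apply/eqP; rewrite eq_le; apply/andP; split; last first.
  by apply/joinsP => j /andP[].
have [_ Es Et EU EI] := congr_axioms E; have [Fr Fs Ft FU FI] := congr_axioms F.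
(* Related elements are both related to their meet, so comparable pairs suffice. *)
suff le_case x y : x <= y -> (x, y) \in congr_val E -> (x, y) \in congr_val F.
  apply/fintype.subsetP => -[x y] Exy.
  have Em : (x `&` y, x) \in congr_val E.
    by apply: Es; have := EI _ _ x Exy; rewrite meetxx meetC.
  have Em' : (x `&` y, y) \in congr_val E by apply: Et Em Exy.
  by apply: Ft (Fs _ _ (le_case _ _ _ Em)) (le_case _ _ _ Em');
    rewrite ?leIl ?leIr.
have [n] := ubnP #|[set w : L | x <= w]|; elim: n x => // n IH x ltn.
rewrite le_eqVlt => /orP[/eqP -> //|xy] Exy.
have [j [jJ jy Njx jx]] := join_irreducible_below xy.
have cj : covby (lower_cover j) j by rewrite lower_cover_unique.
have xj : x `&` j = lower_cover j.
  apply/eqP; rewrite -lower_cover_unique //; case/andP: (cj) => lj /existsPn Nw.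
  have lI : lower_cover j <= x `&` j by rewrite lexI jx ltW.
  have := Nw (x `&` j); rewrite [_ < j]lt_neqAle leIr andbT.
  have -> : x `&` j != j by apply: contraNneq Njx => <-; rewrite leIl.
  by rewrite andbT lt_def lI andbT negbK => /eqP ->.
have Fj : (lower_cover j, j) \in congr_val F.
  suff: cgj j <= F by rewrite cg_le.
  apply: joins_sup; rewrite jJ /= /cgj cg_le.
  by have := EI _ _ j Exy; rewrite xj (meet_idPr jy).
apply: (Ft _ (j `|` x)); first by have := FU _ _ x Fj; rewrite (join_idPr jx).
apply: IH.
- apply: leq_trans (ltn : _ <= n)%N; apply: proper_card; apply/properP; split.
    by apply/fintype.subsetP => w; rewrite !inE leUx => /andP[].
  by exists x; rewrite !inE // leUx (negPf Njx).
- by rewrite leUx jy ltW.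
- by have := EU _ _ j Exy; rewrite [x `|` j]joinC (join_idPl jy).
Qed.

(** Only injectivity depends on the lattice. Each [cgj j] is join-irreducible because a cover
    collapsed by a join of two congruences is collapsed by one of them; conversely, a
    join-irreducible congruence is one of its own generators [cgj j]. *)
Lemma cgj_bijective_inj :
  {in join_irreducibles L &, injective (@cgj d L)} -> cgj_bijective L.
Proof.
split=> //; apply/setP => E; apply/imsetP/idP => [[j]|]; rewrite !inE.
  move=> jJ ->; apply/andP; split.
    apply/eqP => /(congr1 (fun E => (lower_cover j, j) \in congr_val E)).
    rewrite mem_cg => /esym.
    (* Equality is a congruence that keeps [j] apart from its lower cover, so [cgj j] is not the
       bottom congruence. *)
    have cE : is_congruence [set w : L * L | w.1 == w.2].
      by apply: (kernel_congruence (g := id)) => x y z ->.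
    have /fintype.subsetP/[apply] := le0x (Congr cE); rewrite inE /=.
    have := lower_cover_unique (lower_cover j) jJ; rewrite eqxx => /andP[+ _].
    by rewrite lt_neqAle => /andP[/negPf->].
  apply/'forall_'forall_implyP => E1 E2 /eqP jEF.
  have EjEF : (lower_cover j, j) \in congr_val (congr_join E1 E2).
    by have := mem_cg (lower_cover j) j; rewrite -/(cgj j) jEF.
  have := covby_congr_join _ EjEF; rewrite lower_cover_unique // eqxx.
  case/(_ isT)/orP; rewrite -cg_le => jle; apply/orP; [left|right].
    by rewrite eq_le jle jEF leUl.
  by rewrite eq_le jle jEF leUr.
move=> EJ; have [j /andP[jJ _] Ej] :=
  join_irreducible_bigjoin EJ (congr_join_generators E).
by exists j; rewrite ?inE.
Qed.

End CongruenceTheory.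

Lemma is_congruence_dual (d : Order.disp_t) (L : finTBLatticeType d)
  (S : {set L * L}) : is_congruence S -> @is_congruence _ L^d S.
Proof. by case/and5P=> rS sS tS jS mS; apply/and5P; split. Qed.

Lemma covbyP (d : Order.disp_t) (L : finTBLatticeType d) (u v : L) : u < v ->
  (forall w, u <= w -> w <= v -> w = u \/ w = v) -> covby u v.
Proof.
move=> uv H; rewrite /covby uv /=; apply/existsPn => w; apply/negP.
case/andP=> /[dup] /ltW uw + /[dup] /ltW wv.
by case: (H w uw wv) => ->; rewrite ltxx.
Qed.

Lemma lower_coverE (d : Order.disp_t) (L : finTBLatticeType d) (u v : L) :
  join_irreducible v -> covby u v -> lower_cover v = u.
Proof. by move=> vJ; rewrite lower_cover_unique // => /eqP ->. Qed.

Lemma covby_dual (d : Order.disp_t) (L : finTBLatticeType d) (u v : L) :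
  @covby _ L^d u v = covby v u.
Proof.
by rewrite /covby; congr (_ && ~~ _); apply: eq_existsb => w; rewrite andbC.
Qed.

(** * Nuclei and core labels in a finite lattice *)

Section Nucleus.
Variables (d : Order.disp_t) (L : finTBLatticeType d).
Implicit Types u v x y : L.

Lemma join_irreducible_covby u x :
  covby u x -> (forall y, y < x -> y <= u) -> join_irreducible x.
Proof.
move=> /andP[ux _] xu; apply/andP; split.
  by apply: contraTneq ux => ->; rewrite ltx0.
apply/'forall_'forall_implyP => y z /eqP xE; apply/negPn.
rewrite negb_or; apply/negP => /andP[xy xz]; have := lt_geF ux.
by rewrite {1}xE leUx !xu // lt_neqAle ?[y == _]eq_sym ?[z == _]eq_sym ?xy ?xz
  {1}xE ?leUl ?leUr.
Qed.

Lemma nucleus_le x y : covby y x -> nucleus x <= y.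
Proof. by move=> yx; apply: (@meets_inf _ _ _ y (fun y => covby y x) id). Qed.

Lemma nucleus_join_irreducible x :
  join_irreducible x -> nucleus x = lower_cover x.
Proof.
move=> xJ; rewrite /nucleus (big_pred1 (lower_cover x)) // => y.
exact: lower_cover_unique.
Qed.

(** When the nucleus of [y] is the bottom, every cover below [y] contributes its label, in
    particular those used for [x]. *)
Lemma core_label_setS x y :
  x <= y -> nucleus y = \bot -> core_label_set x \subset core_label_set y.
Proof.
move=> xy y0; apply/imsetS/fintype.subsetP => -[u v]; rewrite !inE /= y0 le0x.
by case/and3P=> _ -> /le_trans ->.
Qed.

Lemma core_label_setP j x : reflect
  (exists u v, [/\ nucleus x <= u, covby u v, v <= x & j = j_cg u v])
  (j \in core_label_set x).
Proof.
apply: (iffP imsetP) => [[[u v]]|[u [v [h1 h2 h3 ->]]]].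
  by rewrite inE => /and3P[h1 h2 h3] ->; exists u, v.
by exists (u, v) => //; rewrite inE h1 h2.
Qed.

End Nucleus.

End LatticeTheory.

(* The Boolean lattice on three atoms, one of which is stretched to a chain of
   [k.+1] elements.  [inl (s, t, r)] are the elements of the cube, and the
   [inr i] are the new elements below the atom [inl (false, false, true)]. *)
Definition stretched_cube (k : nat) : Type := (bool * bool * bool + 'I_k)%type.

(** * The stretched cube as a lattice, described by coordinates *)

Section StretchedCube.
Local Open Scope order_scope.
Variable k : nat.
Local Notation T := (stretched_cube k).

HB.instance Definition _ := Finite.on T.

Implicit Types x y z w : T.

(** [inB], [inC] and [height] embed the poset in the product of two two-element chains and the chain
    of heights from [0] to [k.+1]. The heights strictly between occur only for elements above
    neither b nor c. *)
Definition inB x := if x is inl (s, _, _) then s else false.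
Definition inC x := if x is inl (_, s, _) then s else false.
Definition height x : nat :=
  match x with inl (_, _, r) => if r then k.+1 else 0%N | inr i => i.+1 end.

Lemma coord_inj x y :
  inB x = inB y -> inC x = inC y -> height x = height y -> x = y.
Proof.
case: x => [[[s t] r]|i]; case: y => [[[s' t'] r']|j] /=.
- by move=> -> ->; case: r r' => [] [].
- by case: r => _ _ E; have := ltn_ord j; lia.
- by case: r' => _ _ E; have := ltn_ord i; lia.
- by move=> _ _ [E]; congr inr; apply: val_inj.
Qed.

Lemma height_max x : (height x <= k.+1)%N.
Proof. by case: x => [[[s t] []]|i] //=; have := ltn_ord i; lia. Qed.

Lemma height_ends x : inB x || inC x -> height x = 0%N \/ height x = k.+1.
Proof. by case: x => [[[s t] []]|i] //=; auto. Qed.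

(* the least element above the given coordinates *)
Definition hull (s t : bool) (h : nat) : T :=
  if s || t then inl (s, t, 0 < h)%N else
  if h == 0%N then inl (false, false, false) else
  (* The element [inr i] has height [i.+1], hence the shift; an index out of range means the top of
     the chain. *)
  if insub h.-1 is Some i then inr i else inl (false, false, true).

Lemma inB_hull s t h : inB (hull s t h) = s.
Proof. by rewrite /hull; case: s t h => [] [] [] //= h; case: insub. Qed.

Lemma inC_hull s t h : inC (hull s t h) = t.
Proof. by rewrite /hull; case: s t h => [] [] [] //= h; case: insub. Qed.

Lemma height_hull s t h : height (hull s t h) =
  if s || t then (if 0 < h then k.+1 else 0)%N else minn h k.+1.
Proof.
rewrite /hull; case: ifP => [_|_] //=; case: h => [|h] //=.
by case: insubP => [i _ /= E|] /=; [have := ltn_ord i|]; lia.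
Qed.

Definition stretched_le x y :=
  [&& inB x ==> inB y, inC x ==> inC y & height x <= height y]%N.

Fact stretched_le_refl : reflexive stretched_le.
Proof. by move=> x; rewrite /stretched_le !implybb leqnn. Qed.

Fact stretched_le_anti : antisymmetric stretched_le.
Proof.
move=> x y /andP[/and3P[B C h] /and3P[B' C' h']]; apply: coord_inj.
- by move: B B'; case: (inB x) (inB y) => [] [].
- by move: C C'; case: (inC x) (inC y) => [] [].
- lia.
Qed.

Fact stretched_le_trans : transitive stretched_le.
Proof.
move=> y x z /and3P[B C h] /and3P[B' C' h']; apply/and3P; split; last by lia.
- by move: B B'; case: (inB x) (inB y) => [] [].
- by move: C C'; case: (inC x) (inC y) => [] [].
Qed.

Fact stretched_display : Order.disp_t. Proof. exact: Order.Disp tt tt. Qed.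

HB.instance Definition _ :=
  Order.Le_isPOrder.Build stretched_display T
    stretched_le_refl stretched_le_anti stretched_le_trans.

Definition stretched_join x y :=
  hull (inB x || inB y) (inC x || inC y) (maxn (height x) (height y)).
Definition stretched_meet x y :=
  hull (inB x && inB y) (inC x && inC y) (minn (height x) (height y)).

(** [hull] does not raise the height here: if the meet is above b or c, so are both arguments, and
    their heights are [0] or [k.+1]. *)
Lemma height_stretched_meet x y : 
  height (stretched_meet x y) = minn (height x) (height y).
Proof.
rewrite height_hull; have := height_max x; have := height_max y.
have := @height_ends x; have := @height_ends y; case: ifP; last by lia.
by case: (inB x) (inC x) (inB y) (inC y) => [] [] [] [] //= _;
  do 2!case/(_ isT)=> ->; rewrite ?minnn ?minn0 ?min0n.
Qed.

Fact stretched_meetP x y z : (x <= stretched_meet y z) = (x <= y) && (x <= z).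
Proof.
rewrite /Order.le /= /stretched_le height_stretched_meet leq_min.
rewrite inB_hull inC_hull.
move: (inB x) (inB y) (inB z) (inC x) (inC y) (inC z).
by move: (height x <= height y)%N (height x <= height z)%N; do 8!case.
Qed.

(** Rounding a positive height up to [k.+1] happens only above b or c; an upper bound [z] is then
    above b or c too, so a positive height of [z] is already [k.+1]. *)
Fact stretched_joinP x y z : (stretched_join x y <= z) = (x <= z) && (y <= z).
Proof.
rewrite /Order.le /= /stretched_le height_hull inB_hull inC_hull.
have hx := height_max x; have hy := height_max y; have hz := @height_ends z.
have -> : [&& inB x ==> inB z, inC x ==> inC z & height x <= height z]%N &&
          [&& inB y ==> inB z, inC y ==> inC z & height y <= height z]%N =
    [&& inB x || inB y ==> inB z, inC x || inC y ==> inC z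
      & maxn (height x) (height y) <= height z]%N.
  rewrite geq_max; move: (inB x) (inB y) (inB z) (inC x) (inC y) (inC z).
  by move: (height x <= height z)%N (height y <= height z)%N; do 8!case.
case Bz: (_ ==> inB z) => //; case Cz: (_ ==> inC z) => //=.
case: ifP => [st|_]; last by lia.
have [|->|->] := hz.
- by case/orP: st => st; [move: Bz|move: Cz]; rewrite st /= => ->;
    rewrite ?orbT.
- by case: ifP; lia.
- by case: ifP; lia.
Qed.

HB.instance Definition _ := Order.POrder_MeetJoin_isLattice.Build
  stretched_display T stretched_meetP stretched_joinP.

Fact stretched_le0 x : hull false false 0 <= x.
Proof. by rewrite /Order.le /= /stretched_le. Qed.

Fact stretched_le1 x : x <= hull true true 1.
Proof. by rewrite /Order.le /= /stretched_le !implybT height_max. Qed.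

HB.instance Definition _ :=
  Order.hasBottom.Build stretched_display T stretched_le0.
HB.instance Definition _ :=
  Order.hasTop.Build stretched_display T stretched_le1.

Lemma card_stretched_cube : #|{: T}| = (8 + k)%N.
Proof. by rewrite card_sum !card_prod card_bool card_ord. Qed.

Lemma leE x y :
  (x <= y) = [&& inB x ==> inB y, inC x ==> inC y & height x <= height y]%N.
Proof. by []. Qed.

Lemma ltE x y : (x < y) = [&& inB x ==> inB y, inC x ==> inC y
  & height x <= height y]%N && [|| inB y && ~~ inB x, inC y && ~~ inC x
  | height x < height y]%N.
Proof.
rewrite lt_leAnge !leE.
by case: ltngtP => _; case: (inB x) (inB y) (inC x) (inC y) => [] [] [] [].
Qed.

Lemma inBU x y : inB (x `|` y) = inB x || inB y.
Proof. exact: inB_hull. Qed.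

Lemma inCU x y : inC (x `|` y) = inC x || inC y.
Proof. exact: inC_hull. Qed.

Lemma heightU x y : height (x `|` y) =
  if [|| inB x, inB y, inC x | inC y] then
    if (0 < maxn (height x) (height y))%N then k.+1 else 0%N
  else maxn (height x) (height y).
Proof.
rewrite [LHS]height_hull -orbA; case: ifP => // _.
by apply/minn_idPl; rewrite geq_max !height_max.
Qed.

Lemma height_gt0U x y :
  (0 < height (x `|` y))%N = (0 < height x)%N || (0 < height y)%N.
Proof. by rewrite heightU; do ?case: ifP; lia. Qed.

Lemma inBI x y : inB (x `&` y) = inB x && inB y.
Proof. exact: inB_hull. Qed.

Lemma inCI x y : inC (x `&` y) = inC x && inC y.
Proof. exact: inC_hull. Qed.

Lemma heightI x y : height (x `&` y) = minn (height x) (height y).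
Proof. exact: height_stretched_meet. Qed.

Lemma bot_hull : \bot = hull false false 0. Proof. by []. Qed.

Definition hullE := (inB_hull, inC_hull, height_hull).

(** * Congruences that separate the labels *)

Lemma inB_congruence : is_congruence [set w : T * T | inB w.1 == inB w.2].
Proof.
by apply: kernel_congruence => x y z; rewrite ?inBU ?inBI => ->.
Qed.

Lemma inC_congruence : is_congruence [set w : T * T | inC w.1 == inC w.2].
Proof.
by apply: kernel_congruence => x y z; rewrite ?inCU ?inCI => ->.
Qed.

Lemma height_gt0_congruence :
  is_congruence [set w : T * T | (0 < height w.1)%N == (0 < height w.2)%N].
Proof.
apply: (kernel_congruence (g := fun x => (0 < height x)%N)) => x y z.
  by rewrite !height_gt0U => ->.
by rewrite !heightI !leq_min => ->.
Qed.

(* collapses the heights [i.-1] and [i] *)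
Definition squeeze (i : nat) x := (inB x, inC x, height x - (i <= height x))%N.

(** Since [1 < i], heights [0] and [1] stay apart, so the squeezed height still tells whether the
    height is positive. The rounding in a join depends on nothing else. *)
Lemma squeeze_congruence i : (1 < i)%N ->
  is_congruence [set w : T * T | squeeze i w.1 == squeeze i w.2].
Proof.
move=> i1; apply: kernel_congruence => x y z [eB eC eh].
  rewrite /squeeze !inBU !inCU !heightU eB eC; congr (_, _, _).
  case: ifP => _; last by lia.
  suff -> : (0 < maxn (height x) (height z) =
            (0 < maxn (height y) (height z)))%N by [].
  by lia.
by rewrite /squeeze !inBI !inCI !heightI eB eC; congr (_, _, _); lia.
Qed.

Lemma squeeze_chain i h h' : (h <= k.+1)%N -> (h' <= k.+1)%N ->
  (squeeze i (hull false false h) == squeeze i (hull false false h')) =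
  (h - (i <= h) == h' - (i <= h'))%N.
Proof.
by move=> hk hk'; rewrite /squeeze !hullE /= !(minn_idPl _).
Qed.

(** Each of the separating congruences collapses both pairs or neither: a necessary condition for
    equal labels that can be checked on coordinates. *)
Definition same_label x y z w :=
  [/\ (inB x == inB y) = (inB z == inB w),
      (inC x == inC y) = (inC z == inC w),
      ((0 < height x) == (0 < height y))%N =
      ((0 < height z) == (0 < height w))%N
    & forall i, (1 < i)%N ->
      (squeeze i x == squeeze i y) = (squeeze i z == squeeze i w)].

Lemma cg_same_label x y z w : cg x y = cg z w -> same_label x y z w.
Proof.
move=> /eq_cg_mem E; split.
- by have := E _ inB_congruence; rewrite !inE.
- by have := E _ inC_congruence; rewrite !inE.
- by have := E _ height_gt0_congruence; rewrite !inE.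
- by move=> i i1; have := E _ (squeeze_congruence i1); rewrite !inE.
Qed.

Lemma cg_dual_same_label x y z w :
  @cg _ T^d x y = @cg _ T^d z w -> same_label x y z w.
Proof.
move=> /eq_cg_mem E; split.
- by have := E _ (is_congruence_dual inB_congruence); rewrite !inE.
- by have := E _ (is_congruence_dual inC_congruence); rewrite !inE.
- by have := E _ (is_congruence_dual height_gt0_congruence); rewrite !inE.
- move=> i i1.
  by have := E _ (is_congruence_dual (squeeze_congruence i1)); rewrite !inE.
Qed.

(** * Cover relations and irreducible elements *)

Lemma covby_hull s t h s' t' h' :
  hull s t h < hull s' t' h' ->
  (forall sw tw hw, (hw <= k.+1)%N ->
     (sw || tw ==> (hw == 0) || (hw == k.+1))%N ->
     [&& s ==> sw, t ==> tw & height (hull s t h) <= hw]%N ->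
     [&& sw ==> s', tw ==> t' & hw <= height (hull s' t' h')]%N ->
     [|| [&& sw == s, tw == t & hw == height (hull s t h)] |
     [&& sw == s', tw == t' & hw == height (hull s' t' h')]]) ->
  covby (hull s t h) (hull s' t' h').
Proof.
move=> lt H; apply: covbyP => // w; rewrite !leE !inB_hull !inC_hull => h1 h2.
(* The enumeration of coordinates must be confined to triples that come from an element. *)
have hw : (inB w || inC w ==> (height w == 0) || (height w == k.+1))%N.
  by apply/implyP => /height_ends[]->; rewrite eqxx ?orbT.
have /orP[] := H _ _ _ (height_max w) hw h1 h2 => /and3P[/eqP B /eqP C /eqP h0];
  [left|right]; apply: coord_inj; rewrite ?inB_hull ?inC_hull //.
Qed.

Local Ltac covby_tac :=
  apply: covby_hull; [by rewrite ltE !hullE //=; lia |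
  rewrite !height_hull /=; do 2!case; move=> hw /=; lia].

Lemma covby_chain h :
  (h <= k)%N -> covby (hull false false h) (hull false false h.+1).
Proof. move=> hk; covby_tac. Qed.

Lemma covby_atom s : covby (hull false false 0) (hull s (~~ s) 0).
Proof. by case: s; covby_tac. Qed.

Lemma covby_bc s : covby (hull s (~~ s) 0) (hull true true 0).
Proof. by case: s; covby_tac. Qed.

Lemma covby_top s : covby (hull s (~~ s) 1) (hull true true 1).
Proof. by case: s; covby_tac. Qed.

Lemma covby_bc_top : covby (hull true true 0) (hull true true 1).
Proof. covby_tac. Qed.

Lemma covby_rise s : covby (hull s (~~ s) 0) (hull s (~~ s) 1).
Proof. by case: s; covby_tac. Qed.

Lemma covby_chain_top s : covby (hull false false k.+1) (hull s (~~ s) 1).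
Proof. by case: s; covby_tac. Qed.

(** The value [s = true] stands for b and ab, [s = false] for c and ac. Above b or c the argument
    [1] of [hull] is rounded up to height [k.+1]. *)
Variant coord_spec x : Prop :=
  | CoordBot of x = hull false false 0
  | CoordChain h of (h <= k)%N & x = hull false false h.+1
  | CoordAtom s of x = hull s (~~ s) 0
  | CoordCoatom s of x = hull s (~~ s) 1
  | CoordBC of x = hull true true 0
  | CoordTop of x = hull true true 1.

Lemma coordP x : coord_spec x.
Proof.
case: x => [[[[] []] []]|i].
- exact: CoordTop.
- exact: CoordBC.
- exact: (@CoordCoatom _ true).
- exact: (@CoordAtom _ true).
- exact: (@CoordCoatom _ false).
- exact: (@CoordAtom _ false).
- by apply: (@CoordChain _ k) => //; apply: coord_inj; rewrite hullE //= minnn.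
- exact: CoordBot.
- apply: (@CoordChain _ i); first exact: ltnW.
  by apply: coord_inj; rewrite hullE //=; have := ltn_ord i; lia.
Qed.

Lemma hull_neq s t h s' t' h' :
  [|| s != s', t != t' | height (hull s t h) != height (hull s' t' h')] ->
  hull s t h != hull s' t' h'.
Proof.
move=> H; apply/eqP => E; case/or3P: H => /eqP; apply.
- by have := congr1 inB E; rewrite !inB_hull.
- by have := congr1 inC E; rewrite !inC_hull.
- by rewrite E.
Qed.

Lemma join_irreducible_split x y z : join_irreducible x ->
  x = y `|` z -> x != y -> x != z -> False.
Proof.
case/andP=> _ /'forall_'forall_implyP xU /eqP/xU/orP[] /eqP ->; by rewrite eqxx.
Qed.

(** The other elements are proper joins: ab and ac of b or c with the top of the chain, bc of b and
    c, the top of ab and ac. *)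
Lemma join_irreducible_shape x : join_irreducible x ->
  (exists s, x = hull s (~~ s) 0) \/
  (exists2 h, (h <= k)%N & x = hull false false h.+1).
Proof.
move=> xJ; have [E|h hk E|s E|s E|E|E] := coordP x.
- by case/andP: xJ => /eqP.
- by right; exists h.
- by left; exists s.
- case: (@join_irreducible_split x (hull s (~~ s) 0) (hull false false k.+1)
      xJ).
  + by rewrite E; apply: coord_inj; rewrite ?inBU ?inCU ?heightU !hullE ?minnn;
      case: (s).
  + by rewrite E hull_neq //; case: (s).
  + by rewrite E hull_neq //; case: (s).
- case: (@join_irreducible_split x (hull true false 0) (hull false true 0) xJ).
  + by rewrite E; apply: coord_inj; rewrite ?inBU ?inCU ?heightU !hullE.
  + by rewrite E hull_neq.
  + by rewrite E hull_neq.
- case: (@join_irreducible_split x (hull true false 1) (hull false true 1) xJ).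
  + by rewrite E; apply: coord_inj; rewrite ?inBU ?inCU ?heightU !hullE //=
      maxnn.
  + by rewrite E hull_neq.
  + by rewrite E hull_neq.
Qed.

Lemma meet_irreducible_split x y z : @join_irreducible _ T^d x ->
  x = y `&` z -> x != y -> x != z -> False.
Proof.
case/andP=> _ /'forall_'forall_implyP xI /eqP/xI/orP[] /eqP ->; by rewrite eqxx.
Qed.

(** The other elements are the top or proper meets: the bottom of b and c, the top of the chain of
    ab and ac, and b or c of bc with ab or ac. *)
Lemma meet_irreducible_shape x : @join_irreducible _ T^d x ->
  [\/ exists s, x = hull s (~~ s) 1, x = hull true true 0 |
   exists2 h, (0 < h <= k)%N & x = hull false false h].
Proof.
move=> xM; have [E|h hk E|s E|s E|E|E] := coordP x.
- case: (@meet_irreducible_split x (hull true false 0) (hull false true 0) xM).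
  + by rewrite E; apply: coord_inj; rewrite ?inBI ?inCI ?heightI !hullE.
  + by rewrite E hull_neq.
  + by rewrite E hull_neq.
- have [hk'|kh] := ltnP h k; first by apply: Or33; exists h.+1.
  have {kh hk} hk : h = k by apply/eqP; rewrite eqn_leq hk.
  case: (@meet_irreducible_split x (hull true false 1) (hull false true 1) xM).
  + by rewrite E hk; apply: coord_inj; rewrite ?inBI ?inCI ?heightI !hullE.
  + by rewrite E hull_neq.
  + by rewrite E hull_neq.
- case: (@meet_irreducible_split x (hull s (~~ s) 1) (hull true true 0) xM).
  + by rewrite E; apply: coord_inj; rewrite ?inBI ?inCI ?heightI !hullE;
      case: (s); rewrite //= minn0.
  + by rewrite E hull_neq //; case: (s).
  + by rewrite E hull_neq //; case: (s).
- by apply: Or31; exists s.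
- exact: Or32.
- by case/andP: xM => /eqP.
Qed.

(** The cover below b changes only [inB], the one below c only [inC], and those on the chain only
    the height. *)
Lemma cgj_inj : {in join_irreducibles T &, injective (@cgj _ T)}.
Proof.
move=> x y; rewrite !inE => xJ yJ /cg_same_label.
have [[s Ex]|[h hk Ex]] := join_irreducible_shape xJ;
  have [[s' Ey]|[h' hk' Ey]] := join_irreducible_shape yJ.
- rewrite (lower_coverE xJ (u := hull false false 0)) ?Ex ?covby_atom //.
  rewrite (lower_coverE yJ (u := hull false false 0)) ?Ey ?covby_atom //.
  by case; rewrite !hullE; case: s s' {Ex Ey} => [] [].
- rewrite (lower_coverE xJ (u := hull false false 0)) ?Ex ?covby_atom //.
  rewrite (lower_coverE yJ (u := hull false false h')) ?Ey ?covby_chain //.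
  by case; rewrite !hullE; case: s {Ex}.
- rewrite (lower_coverE xJ (u := hull false false h)) ?Ex ?covby_chain //.
  rewrite (lower_coverE yJ (u := hull false false 0)) ?Ey ?covby_atom //.
  by case; rewrite !hullE; case: s' {Ey}.
- rewrite (lower_coverE xJ (u := hull false false h)) ?Ex ?covby_chain //.
  rewrite (lower_coverE yJ (u := hull false false h')) ?Ey ?covby_chain //.
  (* [E1] decides whether the pair is the lowest one of the chain. If not, [h.+1] exceeds [1], and
     [squeeze h.+1] collapses no other pair of neighbours on the chain. *)
  case=> _ _; rewrite !height_hull /= => E1 /(_ h.+1).
  by rewrite !squeeze_chain; do ?[lia]; move=> E2; congr (hull _ _ _.+1); lia.
Qed.

Variant meet_irreducible_spec x (z : T) : Prop :=
  | MIrrCoatom s of x = hull s (~~ s) 1 & z = hull true true 1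
  | MIrrBC of x = hull true true 0 & z = hull true true 1
  | MIrrChain h of (0 < h <= k)%N & x = hull false false h
                 & z = hull false false h.+1.

(** In the dual lattice [lower_cover] is the unique upper cover of a meet-irreducible element. *)
Lemma upper_cover_shape x : @join_irreducible _ T^d x ->
  meet_irreducible_spec x (@lower_cover _ T^d x).
Proof.
move=> xM; have [[s E]|E|[h /andP[h0 hk] E]] := meet_irreducible_shape xM.
- apply: (@MIrrCoatom _ _ s) => //.
  by apply: (lower_coverE xM); rewrite covby_dual E covby_top.
- apply: MIrrBC => //.
  by apply: (lower_coverE xM); rewrite covby_dual E covby_bc_top.
- apply: (@MIrrChain _ _ h); rewrite ?h0 //.
  by apply: (lower_coverE xM); rewrite covby_dual E covby_chain.
Qed.

(** Going up to the top changes [inC] from ab, [inB] from ac and positivity of the height from bc.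
    Pairs on the chain have [0 < h], so they keep all three and are told apart by [squeeze h.+1]. *)
Lemma cgj_dual_inj : {in join_irreducibles T^d &, injective (@cgj _ T^d)}.
Proof.
move=> x y; rewrite !inE => xM yM /cg_dual_same_label.
have [s -> ->|-> ->|h hk -> ->] := upper_cover_shape xM;
  have [s' -> ->|-> ->|h' hk' -> ->] := upper_cover_shape yM;
  case; rewrite !hullE ?orbF /=.
- by case: s s' => [] [].
- by case: s.
- by case: s.
- by case: s'.
- by [].
- by move=> _ _; lia.
- by case: s'.
- by move=> _ _; lia.
- move=> _ _ _ /(_ h.+1).
  by rewrite !squeeze_chain; do ?[lia]; move=> E2; congr (hull _ _ _); lia.
Qed.

Lemma stretched_cube_congruence_uniform : congruence_uniform T.
Proof.
by split; apply: cgj_bijective_inj; [apply: cgj_inj|apply: cgj_dual_inj].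
Qed.

(** * Core labels of the stretched cube *)

Lemma j_cg_lower_cover x : join_irreducible x -> j_cg (lower_cover x) x = x.
Proof.
move=> xJ; rewrite /j_cg; case: pickP => [y /andP[yJ /eqP]|/(_ x)] /=.
  by apply: cgj_inj => //; rewrite inE.
by rewrite inE xJ eqxx.
Qed.

Lemma join_irreducible_atom s : join_irreducible (hull s (~~ s) 0).
Proof.
apply: join_irreducible_covby (covby_atom s) _ => y.
by rewrite ltE leE !hullE; case: (s) (inB y) (inC y) => [] [] [] /=; lia.
Qed.

Lemma join_irreducible_chain h :
  (h <= k)%N -> join_irreducible (hull false false h.+1).
Proof.
move=> hk; apply: join_irreducible_covby (covby_chain hk) _ => y.
by rewrite ltE leE !hullE; case: (inB y) (inC y) => [] [] /=; lia.
Qed.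

(** The nucleus is the lower cover, so the only cover that counts is the one from it to [x]. *)
Lemma core_label_set_join_irreducible x :
  join_irreducible x -> core_label_set x = [set x].
Proof.
move=> xJ; have cx : covby (lower_cover x) x by rewrite lower_cover_unique.
apply/setP => j; rewrite !inE; apply/core_label_setP/eqP => [[u [v []]]|->].
  rewrite nucleus_join_irreducible // => xu /andP[uv Nw] vx ->.
  have E : u = lower_cover x.
    case/andP: cx => _ /existsPn /(_ u); rewrite (lt_le_trans uv vx) andbT.
    by rewrite lt_def xu andbT negbK => /eqP.
  suff -> : v = x by rewrite E j_cg_lower_cover.
  case/andP: cx => _ /existsPn /(_ v); rewrite -E uv /=.
  by rewrite lt_neqAle vx andbT negbK => /eqP.
exists (lower_cover x), x; rewrite nucleus_join_irreducible // lexx lexx.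
by rewrite j_cg_lower_cover.
Qed.

(** Some lower covers already meet in the bottom: the bottom itself for b and c, an atom and the top
    of the chain for ab and ac, b and c for bc, all three coatoms for the top. *)
Lemma nucleus_bot x : inB x || inC x -> nucleus x = \bot.
Proof.
have toP y z : covby y x -> covby z x -> y `&` z = \bot -> nucleus x = \bot.
  move=> yx zx yz; apply/eqP; rewrite -lex0 -yz lexI.
  by rewrite !nucleus_le.
have [E|h hk E|s E|s E|E|E] := coordP x; rewrite E !hullE // => _.
- by apply/eqP; rewrite -lex0; apply: nucleus_le; apply: covby_atom.
- rewrite -E; apply: (toP (hull s (~~ s) 0) (hull false false k.+1)).
  + by rewrite E covby_rise.
  + by rewrite E covby_chain_top.
  + by apply: coord_inj; rewrite ?inBI ?inCI ?heightI !hullE; case: (s);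
      rewrite //= min0n.
- rewrite -E; apply: (toP (hull true false 0) (hull false true 0)).
  + by rewrite E (covby_bc true).
  + by rewrite E (covby_bc false).
  + by apply: coord_inj; rewrite ?inBI ?inCI ?heightI !hullE.
- have /nucleus_le := covby_top true; have /nucleus_le := covby_top false.
  have /nucleus_le := covby_bc_top; rewrite !leE !hullE /= => n1 n2 n3.
  apply: coord_inj; rewrite ?bot_hull ?hullE /=; move: n1 n2 n3;
    by case: (inB _) (inC _) => [] [] //=; lia.
Qed.

(** A cover labelled by b changes [inB], so its upper end, and with it [x], is above b; likewise for
    c. *)
Lemma atom_core_label s x :
  hull s (~~ s) 0 \in core_label_set x -> if s then inB x else inC x.
Proof.
have aJ := join_irreducible_atom s.
case/core_label_setP=> u [v [_ /andP[uv _] vx]].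
(* The default value of [j_cg] is the bottom, which is not join-irreducible. *)
rewrite /j_cg; case: pickP => [j /andP[jJ /eqP ej] E|_ E] /=; last first.
  by case/andP: aJ => /eqP.
have {jJ}E : hull s (~~ s) 0 = j := E.
move: ej; rewrite -E => /cg_same_label.
rewrite (lower_coverE aJ (covby_atom s)) => -[]; move: uv vx.
rewrite ltE leE !hullE.
by case: (s) (inB u) (inB v) (inB x) (inC u) (inC v) (inC x)
  => [] [] [] [] [] [] [].
Qed.

Lemma inB_inC_core_label s x :
  (if s then inB x else inC x) -> hull s (~~ s) 0 \in core_label_set x.
Proof.
move=> sx; have ax : hull s (~~ s) 0 <= x.
  by rewrite leE !hullE; case: s sx => /= ->; rewrite ?implybT.
have x0 : nucleus x = \bot.
  by apply: nucleus_bot; case: s sx {ax} => ->; rewrite ?orbT.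
apply: (fintype.subsetP (core_label_setS ax x0)).
by rewrite core_label_set_join_irreducible ?join_irreducible_atom // set11.
Qed.

Lemma core_label_set_bot j : j \notin core_label_set (\bot : T).
Proof.
apply/core_label_setP => -[u [v [_ /andP[uv _]]]]; rewrite lex0 => /eqP E _.
by move: uv; rewrite E ltx0.
Qed.

(* The chain elements are common lower bounds of the two coatoms above the
   chain, but each has a single label. *)
Lemma core_label_order_not_lattice : (0 < k)%N ->
  ~ is_lattice (@core_label_order _ T).
Proof.
move=> k0 /(_ (hull true false 1) (hull false true 1))[[m [mB mC mP]] _].
(* Since [0 < k], the heights [1] and [2] give two distinct chain elements, whose labels must both
   belong to [m]. *)
have chain_label h : (h <= 1)%N -> hull false false h.+1 \in core_label_set m.
  move=> h1; have hJ : join_irreducible (hull false false h.+1).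
    by apply: join_irreducible_chain; lia.
  suff /fintype.subsetP :
      core_label_set (hull false false h.+1) \subset core_label_set m.
    by apply; rewrite core_label_set_join_irreducible // set11.
  by apply: mP; apply: core_label_setS;
    rewrite ?nucleus_bot ?leE ?hullE //=; lia.
(* Otherwise b would be a core label of [m], hence of ac. *)
have NB : ~~ inB m.
  apply/negP => /(@inB_inC_core_label true) /(fintype.subsetP mC)
    /atom_core_label.
  by rewrite hullE.
have NC : ~~ inC m.
  apply/negP => /(@inB_inC_core_label false) /(fintype.subsetP mB)
    /atom_core_label.
  by rewrite hullE.
(* So [m] is the bottom or on the chain and has at most one label, not two. *)
have := chain_label 0%N isT; have := chain_label 1%N isT.
move: NB NC; have [->|h hk ->|s ->|s ->|->|->] := coordP m; rewrite ?hullE //.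
- by rewrite (negPf (core_label_set_bot _)).
- rewrite core_label_set_join_irreducible ?join_irreducible_chain // !inE.
  move=> _ _ /eqP <- /eqP /(congr1 height); rewrite !hullE /=; lia.
- by case: s.
- by case: s.
Qed.

End StretchedCube.

(** * Continuity into subspaces, products and row vectors, and of real functions *)

Section ContinuityCriteria.
Local Open Scope classical_set_scope.
Local Open Scope ring_scope.

Lemma continuous_set_type (X Y : topologicalType) (A : set Y)
  (f : X -> set_type A) : continuous (fun x => \val (f x)) -> continuous f.
Proof. exact: (@continuous_comp_initial (set_type A) X Y set_val f). Qed.

Lemma continuous_val (Y : topologicalType) (A : set Y) :
  continuous (fun x : set_type A => \val x).
Proof. exact: (@initial_continuous (set_type A) Y set_val). Qed.

Lemma continuous_ptws (X Y : topologicalType) (V : Type)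
  (f : X -> prod_topology (fun _ : V => Y)) :
  (forall v, continuous (fun x => f x v)) -> continuous f.
Proof.
move=> fc x; apply/cvg_sup => v.
exact: (@continuous_comp_initial _ X Y (fun g : V -> Y => g v) f (fc v) x).
Qed.

Lemma continuous_proj (Y : topologicalType) (V : eqType) (v : V) :
  continuous (fun f : prod_topology (fun _ : V => Y) => f v).
Proof. exact: (@proj_continuous V (fun=> Y) v). Qed.

Lemma continuous_rV (X Y : topologicalType) (m : nat) (f : X -> 'rV[Y]_m) :
  (forall i, continuous (fun x => f x ord0 i)) -> continuous f.
Proof.
move=> fc x U [P PM PU]; rewrite /= nbhs_simpl.
suff : \forall y \near x, forall i j, P i j (f y i j).
  by apply: filterS => y Py; apply: PU.
apply: filter_forall => i; apply: filter_forall => j.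
by rewrite (ord1 i); apply: (fc j x); have := PM i j; rewrite (ord1 i).
Qed.

Variables (R : realType) (X : topologicalType).
Implicit Types f g : X -> R.

Lemma continuous_add f g :
  continuous f -> continuous g -> continuous (fun x => f x + g x).
Proof. by move=> fc gc x; apply: cvgD; [apply: fc|apply: gc]. Qed.

Lemma continuous_sub f g :
  continuous f -> continuous g -> continuous (fun x => f x - g x).
Proof. by move=> fc gc x; apply: cvgB; [apply: fc|apply: gc]. Qed.

Lemma continuous_opp f : continuous f -> continuous (fun x => - f x).
Proof. by move=> fc x; apply: cvgN; apply: fc. Qed.

Lemma continuous_mul f g :
  continuous f -> continuous g -> continuous (fun x => f x * g x).
Proof. by move=> fc gc x; apply: cvgM; [apply: fc|apply: gc]. Qed.

Lemma continuous_inv f : (forall x, f x != 0) ->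
  continuous f -> continuous (fun x => (f x)^-1).
Proof. by move=> f0 fc x; apply: cvgV => //; apply: fc. Qed.

Lemma continuous_maxr f g :
  continuous f -> continuous g -> continuous (fun x => Num.max (f x) (g x)).
Proof. by move=> fc gc x; apply: continuous_max; [apply: fc|apply: gc]. Qed.

Lemma continuous_minr f g :
  continuous f -> continuous g -> continuous (fun x => Num.min (f x) (g x)).
Proof. by move=> fc gc x; apply: continuous_min; [apply: fc|apply: gc]. Qed.

Lemma continuous_sumr (I : finType) (P : pred I) (F : I -> X -> R) :
  (forall i, continuous (F i)) -> continuous (fun x => \sum_(i | P i) F i x).
Proof.
move=> Fc x; apply: cvg_big => [|i _]; last exact: Fc.
exact: add_continuous.
Qed.

End ContinuityCriteria.

(** * Piecewise linear coordinates on the hexagon *)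

Section Hexagon.
Local Open Scope ring_scope.
Variable R : realType.
Implicit Types u v c : R.

(* Barycentric weights of [(u, v)] on the hexagon with vertices
   [(1, 0), (1, 1), (0, 1), (-1, 0), (-1, -1), (0, -1)], which carry the
   labels a, ab, b, bc, c, ac of the proper part of the cube. *)
Definition hexagon (s : bool * bool * bool) (u v : R) : R :=
  match s with
  | (false, false, true) => Num.max 0 (Num.min u (u - v))
  | (true, false, true) => Num.max 0 (Num.min u v)
  | (true, false, false) => Num.max 0 (Num.min v (v - u))
  | (true, true, false) => Num.max 0 (Num.min (- u) (v - u))
  | (false, true, false) => Num.max 0 (Num.min (- u) (- v))
  | (false, true, true) => Num.max 0 (Num.min (- v) (u - v))
  | _ => 0
  end.

(** [planeX] and [planeY] are the coordinates of the sum of the hexagon vertices weighted by [w]. *)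
Definition planeX (w : bool * bool * bool -> R) : R :=
  w (false, false, true) + w (true, false, true)
  - w (false, true, false) - w (true, true, false).

Definition planeY (w : bool * bool * bool -> R) : R :=
  w (true, false, false) + w (true, false, true)
  - w (false, true, false) - w (false, true, true).

Local Ltac resolve_minmax :=
  repeat match goal with
  | |- context [Num.min ?a ?b] =>
    first [ have -> : Num.min a b = a by (apply/min_idPl; lra)
          | have -> : Num.min a b = b by (apply/min_idPr; lra) ]
  end;
  repeat match goal with
  | |- context [Num.max ?a ?b] =>
    first [ have -> : Num.max a b = a by (apply/max_idPl; lra)
          | have -> : Num.max a b = b by (apply/max_idPr; lra) ]
  end.

(** The signs of [u], [v] and [u - v] determine the sector of the plane and thereby every minimum
    and maximum. *)
Lemma planeX_hexagon u v : planeX (fun s => hexagon s u v) = u.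
Proof.
rewrite /planeX /hexagon; have [u0|u0] := leP u 0; have [v0|v0] := leP v 0;
  have [uv|uv] := leP u v; resolve_minmax; lra.
Qed.

Lemma planeY_hexagon u v : planeY (fun s => hexagon s u v) = v.
Proof.
rewrite /planeY /hexagon; have [u0|u0] := leP u 0; have [v0|v0] := leP v 0;
  have [uv|uv] := leP u v; resolve_minmax; lra.
Qed.

Lemma hexagon_ge0 s u v : 0 <= hexagon s u v.
Proof. by case: s => [[[] []] []] //=; rewrite le_max lexx. Qed.

Lemma hexagonZ s c u v :
  0 <= c -> hexagon s (c * u) (c * v) = c * hexagon s u v.
Proof.
move=> c0; case: s => [[[] []] []] /=;
  by rewrite ?mulr0 // maxr_pMr // minr_pMr // ?mulr0 ?mulrBr ?mulrN.
Qed.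

Definition cube_comparable (s t : bool * bool * bool) :=
  [&& s.1.1 ==> t.1.1, s.1.2 ==> t.1.2 & s.2 ==> t.2] ||
  [&& t.1.1 ==> s.1.1, t.1.2 ==> s.1.2 & t.2 ==> s.2].

Lemma hexagon_comparable s t u v :
  hexagon s u v != 0 -> hexagon t u v != 0 -> cube_comparable s t.
Proof.
have pos (a b : R) : Num.max 0 (Num.min a b) != 0 -> 0 < a /\ 0 < b.
  by move=> h; split; rewrite ltNge; apply: contraNN h => h;
    apply/eqP/max_idPl; rewrite ge_min h ?orbT.
by case: s t => [[[] []] []] [[[] []] []] //=; rewrite ?eqxx //
  => /pos[? ?] /pos[? ?]; lra.
Qed.

(** Here [x] is the weight of a vertex, [p] and [p'] those of its neighbours, [q] and [q'] those of
    vertices incomparable to it. If [x] vanishes, one argument of the minimum is at most [0];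
    otherwise [q] and [q'] vanish, and so does [p] or [p']. *)
Lemma clip_min (x p q p' q' : R) :
  0 <= x -> 0 <= p -> 0 <= q -> 0 <= p' -> 0 <= q' ->
  x * q = 0 -> x * q' = 0 -> p * p' = 0 ->
  Num.max 0 (Num.min (x + p - q) (x + p' - q')) = x.
Proof.
move=> x0 p0 q0 p'0 q'0 /eqP xq /eqP xq' /eqP pp.
have [ex|nx] := eqVneq x 0.
  rewrite ex !add0r; apply/max_idPl; rewrite ge_min.
  by move: pp; rewrite mulf_eq0 => /orP[]/eqP->;
    rewrite sub0r oppr_le0 ?q0 ?q'0 ?orbT.
move: xq xq'; rewrite !mulf_eq0 (negPf nx) /= => /eqP -> /eqP ->.
rewrite !subr0; move: pp; rewrite mulf_eq0 => /orP[]/eqP->; rewrite addr0.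
  by rewrite (min_idPl _) ?lerDl //; apply/max_idPr.
by rewrite (min_idPr _) ?lerDl //; apply/max_idPr.
Qed.

Lemma hexagonK (w : bool * bool * bool -> R) :
  (forall s, 0 <= w s) ->
  w (false, false, false) = 0 -> w (true, true, true) = 0 ->
  (forall s t, w s != 0 -> w t != 0 -> cube_comparable s t) ->
  forall s, hexagon s (planeX w) (planeY w) = w s.
Proof.
move=> w0 wbot wtop wcmp.
have wM s t : ~~ cube_comparable s t -> w s * w t = 0.
  move=> Nst; apply/eqP; rewrite mulf_eq0; apply/negPn; rewrite negb_or.
  by apply/negP => /andP[ws wt]; rewrite wcmp in Nst.
have wMD s t t' : ~~ cube_comparable s t -> ~~ cube_comparable s t' ->
    w s * (w t + w t') = 0 by move=> *; rewrite mulrDr !wM ?addr0.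
(* The two arguments of the minimum for [s] each contain [s], one neighbour of [s], and two labels
   incomparable to [s] with negative sign. *)
have clip s p q r p' q' r' u v : u = w s + w p - (w q + w r) ->
    v = w s + w p' - (w q' + w r') ->
    ~~ cube_comparable s q && ~~ cube_comparable s r ->
    ~~ cube_comparable s q' && ~~ cube_comparable s r' ->
    ~~ cube_comparable p p' -> Num.max 0 (Num.min u v) = w s.
  move=> -> -> /andP[sq sr] /andP[sq' sr'] pp'.
  by apply: clip_min; rewrite ?addr_ge0 ?wMD ?wM.
pose a := (false, false, true); pose ab := (true, false, true).
pose b := (true, false, false); pose bc := (true, true, false).
pose c := (false, true, false); pose ac := (false, true, true).
rewrite /planeX /planeY => -[[[] []] []] //=.
- by apply: (clip bc c a ab b a ac) => //; ring.
- by apply: (clip ab a c bc b c ac) => //; ring.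
- by apply: (clip b ab c ac bc a ac) => //; ring.
- by apply: (clip ac c b ab a b bc) => //; ring.
- by apply: (clip c bc a ab ac b ab) => //; ring.
- by apply: (clip a ab c bc ac b bc) => //; ring.
Qed.

Lemma hexagon_sum_gt0 u v :
  (u != 0) || (v != 0) -> 0 < \sum_s hexagon s u v.
Proof.
move=> uv; rewrite lt_def sumr_ge0 ?andbT => [|s _]; last exact: hexagon_ge0.
apply: contraL uv => /eqP /psumr_eq0P h; rewrite negb_or !negbK.
have {}h s : hexagon s u v = 0 by apply: h => // t _; apply: hexagon_ge0.
have := planeX_hexagon u v; have := planeY_hexagon u v.
by rewrite /planeX /planeY !h !subr0 addr0 => <- <-; rewrite eqxx.
Qed.

Lemma hexagon00 s : hexagon s 0 0 = 0.
Proof.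
by have := @hexagonZ s 0 0 0 (lexx 0); rewrite !mul0r.
Qed.

End Hexagon.

(** * Collapsing the chain to a single vertex *)

Section CubeClass.
Variable k : nat.
Local Notation V := (stretched_cube k).
Implicit Types x y : V.
Local Open Scope order_scope.

Definition cube_class x : bool * bool * bool :=
  (inB x, inC x, (0 < height x)%N).

(* moves the new elements of the chain to its top *)
Definition cube_retract x : V := inl (cube_class x).

Lemma cube_class_inl s : cube_class (inl s : V) = s.
Proof. by case: s => [[s t] []]. Qed.

Lemma cube_class_comparable x y :
  x >=< y -> cube_comparable (cube_class x) (cube_class y).
Proof.
have mono z t : z <= t -> [&& inB z ==> inB t, inC z ==> inC t
    & (0 < height z)%N ==> (0 < height t)%N].
  rewrite leE => /and3P[-> -> h]; apply/implyP => z0.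
  exact: leq_trans z0 h.
by case/orP=> /mono h; apply/orP; [left|right].
Qed.

Lemma inl_comparable s t :
  cube_comparable s t -> (inl s : V) >=< (inl t : V).
Proof.
rewrite /Order.comparable !leE.
by case: s t => [[[] []] []] [[[] []] []] //=; rewrite ?leqnn ?orbT.
Qed.

(** Elements above b or c have height [0] or [k.+1], so one that lies above any chain element lies
    above the top of the chain. *)
Lemma cube_retract_comparable x y : x >=< y -> cube_retract x >=< y.
Proof.
rewrite /Order.comparable !leE /=.
have := @height_ends _ x; have := height_max x.
have := @height_ends _ y; have := height_max y.
case: (inB x) (inC x) (inB y) (inC y) => [] [] [] [] //=; do ?[move/(_ isT)];
  case: ifP; lia.
Qed.

Lemma mem_proper_part x : (x \in proper_part V) =
  (cube_class x != (false, false, false)) &&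
  (cube_class x != (true, true, true)).
Proof.
rewrite inE; congr (~~ _ && ~~ _); apply/eqP/eqP => [->|].
- by [].
- by case=> B C h; apply: coord_inj; rewrite ?B ?C //=; lia.
- by [].
- case=> B C h; apply: coord_inj; rewrite ?B ?C //=.
  by have := @height_ends _ x; rewrite B => /(_ isT)[]; lia.
Qed.

End CubeClass.

(** * Maps between the realization and the circle *)

Section Realization.
Local Open Scope classical_set_scope.
Local Open Scope ring_scope.
Variables (R : realType) (k : nat).
Local Notation V := (stretched_cube k).
Local Notation K := (realization R (order_complex V)).
Implicit Types (x : V -> R) (s t : bool * bool * bool).

Lemma realizationP x : K x <->
  [/\ forall v, 0 <= x v, \sum_v x v = 1,
      forall v, x v != 0 -> v \in proper_part V
    & forall v v', x v != 0 -> x v' != 0 -> (v >=< v')%O].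
Proof.
split=> [[x0 x1]|[x0 x1 xp xc]].
  rewrite inE => /andP[/fintype.subsetP xp /forall_inP xc].
  split=> // [v xv|v v' xv xv']; first by apply: xp; rewrite inE.
  by apply: (forall_inP (xc v _)); rewrite inE.
split=> //; rewrite inE; apply/andP; split.
  by apply/fintype.subsetP => v; rewrite inE => /xp.
apply/forall_inP => v; rewrite inE => xv.
by apply/forall_inP => v'; rewrite inE => xv'; apply: xc.
Qed.

Definition weight x s : R := \sum_(v | cube_class v == s) x v.

Lemma weight_ge0 x s : (forall v, 0 <= x v) -> 0 <= weight x s.
Proof. by move=> x0; apply: sumr_ge0. Qed.

Lemma sum_weight x : \sum_s weight x s = \sum_v x v.
Proof. by rewrite [RHS](partition_big (@cube_class k) xpredT). Qed.

Lemma weight_neq0 x s :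
  weight x s != 0 -> exists2 v, cube_class v = s & x v != 0.
Proof.
move=> h; have [v /andP[/eqP vs xv]|N] :=
    pickP (fun v => (cube_class v == s) && (x v != 0)); first by exists v.
case/eqP: h; apply: big1 => v vs; have := N v; rewrite vs.
by move/negbFE/eqP.
Qed.

Lemma hexagon_weight x s : K x ->
  hexagon s (planeX (weight x)) (planeY (weight x)) = weight x s.
Proof.
case/realizationP=> x0 _ xp xc; apply: hexagonK => [t|||t t'].
- exact: weight_ge0.
- apply/eqP; apply: contraT => /weight_neq0[v vs /xp].
  by rewrite mem_proper_part vs.
- apply/eqP; apply: contraT => /weight_neq0[v vs /xp].
  by rewrite mem_proper_part vs andbF.
- case/weight_neq0=> v <- xv /weight_neq0[v' <- xv'].
  by apply: cube_class_comparable; apply: xc.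
Qed.

Definition norm2 (u v : R) := Num.sqrt (u ^+ 2 + v ^+ 2).

Lemma norm2_gt0 u v : (u != 0) || (v != 0) -> 0 < norm2 u v.
Proof.
move=> uv; rewrite sqrtr_gt0 lt_def addr_ge0 ?sqr_ge0 // andbT.
by rewrite paddr_eq0 ?sqr_ge0 // !sqrf_eq0 negb_and.
Qed.

(** The weights can be recovered from the plane coordinates, and they sum to [1], so both
    coordinates cannot vanish. This makes radial projection possible. *)
Lemma plane_neq0 x : K x ->
  (planeX (weight x) != 0) || (planeY (weight x) != 0).
Proof.
move=> Kx; rewrite -negb_and; apply/negP => /andP[/eqP X0 /eqP Y0].
have : \sum_s weight x s = 1 by rewrite sum_weight; case: Kx.
rewrite big1 => [/esym/eqP|s _]; first by rewrite oner_eq0.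
by rewrite -hexagon_weight // X0 Y0 hexagon00.
Qed.

Definition to_circle x : 'rV[R]_2 :=
  let u := planeX (weight x) in let v := planeY (weight x) in
  \row_i ((if i == ord0 then u else v) / norm2 u v).

(** The inverse of radial projection: dividing by the sum moves [p] along its ray onto the
    hexagon. *)
Definition of_circle (p : 'rV[R]_2) (v : V) : R :=
  if v is inl s then
    hexagon s (p ord0 ord0) (p ord0 ord_max) /
      \sum_t hexagon t (p ord0 ord0) (p ord0 ord_max)
  else 0.

Lemma circleE (p : 'rV[R]_2) :
  unit_sphere R 2 p <-> p ord0 ord0 ^+ 2 + p ord0 ord_max ^+ 2 = 1.
Proof.
rewrite /unit_sphere /= big_ord_recl big_ord1.
by have -> : lift ord0 ord0 = ord_max :> 'I_2 by apply: val_inj.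
Qed.

Lemma to_circleP x : K x -> unit_sphere R 2 (to_circle x).
Proof.
move=> Kx; apply/circleE; rewrite !mxE /= !expr_div_n -mulrDl.
have := norm2_gt0 (plane_neq0 Kx); set u := planeX _; set v := planeY _ => n0.
rewrite /norm2 sqr_sqrtr ?addr_ge0 ?sqr_ge0 // divff //.
by move: n0; rewrite sqrtr_gt0 => /lt0r_neq0.
Qed.

Lemma circle_neq0 (p : 'rV[R]_2) : unit_sphere R 2 p ->
  (p ord0 ord0 != 0) || (p ord0 ord_max != 0).
Proof.
move/circleE; apply: contra_eqT; rewrite negb_or !negbK.
case/andP=> /eqP -> /eqP ->.
by rewrite expr0n addr0 eq_sym oner_eq0.
Qed.

Lemma sum_inl x : (forall i, x (inr i) = 0) -> \sum_v x v = \sum_s x (inl s).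
Proof.
by move=> x0; rewrite big_sumType /= [X in _ + X]big1 ?addr0.
Qed.

Lemma weight_inl x s : (forall i, x (inr i) = 0) -> weight x s = x (inl s).
Proof.
move=> x0; rewrite /weight big_sumType /= [X in _ + X]big1 ?addr0 //.
by rewrite (big_pred1 s) // => t; rewrite /= cube_class_inl.
Qed.

Lemma of_circleP (p : 'rV[R]_2) : unit_sphere R 2 p -> K (of_circle p).
Proof.
move=> /circle_neq0 /hexagon_sum_gt0 N0; apply/realizationP; split.
- case=> [s|i] //=; rewrite divr_ge0 ?hexagon_ge0 //; exact: ltW.
- by rewrite sum_inl //= -mulr_suml divff // lt0r_neq0.
- case=> [s|i] /=; last by rewrite eqxx.
  rewrite mulf_eq0 negb_or mem_proper_part cube_class_inl => /andP[h _].
  by case: s h => [[[] []] []] //=; rewrite eqxx.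
- case=> [s|i] [t|j] /=; rewrite ?eqxx // !mulf_eq0 !negb_or.
  move=> /andP[hs _] /andP[ht _]; apply: inl_comparable.
  exact: hexagon_comparable hs ht.
Qed.

Lemma of_circleK p : unit_sphere R 2 p -> to_circle (of_circle p) = p.
Proof.
move=> /[dup] /circleE p1 /circle_neq0 p0; have N0 := hexagon_sum_gt0 p0.
set N := \sum_s _ in N0.
have plane : planeX (weight (of_circle p)) = p ord0 ord0 / N /\
             planeY (weight (of_circle p)) = p ord0 ord_max / N.
  split; [rewrite -[in RHS](planeX_hexagon (p ord0 ord0) (p ord0 ord_max))
         |rewrite -[in RHS](planeY_hexagon (p ord0 ord0) (p ord0 ord_max))];
    by rewrite /planeX /planeY !weight_inl //= -/N !mulrDl !mulNr.
rewrite /to_circle plane.1 plane.2.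
have -> : norm2 (p ord0 ord0 / N) (p ord0 ord_max / N) = N^-1.
  rewrite /norm2 !expr_div_n -mulrDl p1 mul1r -exprVn sqrtr_sqr ger0_norm //.
  by rewrite invr_ge0 ltW.
apply/rowP => i; rewrite mxE invrK.
have -> : (if i == ord0 then p ord0 ord0 / N else p ord0 ord_max / N) =
    p ord0 i / N.
  case: i => [[|[|//]]] i2 /=; congr (p _ _ / _); exact: val_inj.
by rewrite divfK // lt0r_neq0.
Qed.

(** By homogeneity of [hexagon] the norm cancels. The composite therefore moves all weight on the
    chain to its top. *)
Lemma to_circleK x v : K x -> of_circle (to_circle x) v =
  if v is inl s then weight x s else 0.
Proof.
move=> Kx; have n0 := norm2_gt0 (plane_neq0 Kx).
have hexE s : hexagon s (to_circle x ord0 ord0) (to_circle x ord0 ord_max) =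
    (norm2 (planeX (weight x)) (planeY (weight x)))^-1 * weight x s.
  rewrite !mxE /= ![_ / norm2 _ _]mulrC hexagonZ ?hexagon_weight //.
  by rewrite invr_ge0 ltW.
case: v => // s; rewrite /of_circle hexE (eq_bigr _ (fun t _ => hexE t)).
rewrite -mulr_sumr sum_weight; have [_ -> _] := Kx.
by rewrite mulr1 invrK mulrC mulrA divff ?mul1r // lt0r_neq0.
Qed.

(** The support of the retracted point consists of images under [cube_retract] of the support of
    [x], so the two supports together still form a chain. *)
Lemma segmentP x c : K x -> 0 <= c <= 1 ->
  K (fun v => (1 - c) * of_circle (to_circle x) v + c * x v).
Proof.
move=> Kx /andP[c0 c1]; have Kg := of_circleP (to_circleP Kx).
have [x0 x1 xp xc] := (realizationP x).1 Kx.
have [g0 g1 gp _] := (realizationP _).1 Kg.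
have gx v : of_circle (to_circle x) v != 0 ->
    exists2 v', x v' != 0 & v = cube_retract v'.
  rewrite to_circleK //; case: v => [s|i]; last by rewrite eqxx.
  by case/weight_neq0=> v' <- xv'; exists v'.
have supp v : (1 - c) * of_circle (to_circle x) v + c * x v != 0 ->
    (of_circle (to_circle x) v != 0) || (x v != 0).
  rewrite -negb_and; apply: contraNN => /andP[/eqP -> /eqP ->].
  by rewrite !mulr0 addr0.
apply/realizationP; split.
- by move=> v; rewrite addr_ge0 ?mulr_ge0 ?subr_ge0.
- by rewrite big_split /= -!mulr_sumr g1 x1 !mulr1 subrK.
- by move=> v /supp/orP[/gp|/xp].
- move=> v v' /supp/orP[/gx[z xz ->]|xv] /supp/orP[/gx[z' xz' ->]|xv'].
  + apply: cube_retract_comparable; rewrite comparable_sym.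
    by apply: cube_retract_comparable; apply: xc.
  + by apply: cube_retract_comparable; apply: xc.
  + by rewrite comparable_sym; apply: cube_retract_comparable; apply: xc.
  + exact: xc.
Qed.

End Realization.

(** * The homotopy equivalence with the circle *)

Section Spherical.
Local Open Scope classical_set_scope.
Local Open Scope ring_scope.
Variables (R : realType) (k : nat).
Local Notation V := (stretched_cube k).
Local Notation X := (set_type (realization R (order_complex V))).
Local Notation S1 := (set_type (unit_sphere R 2)).

Lemma continuous_planeX (Y : topologicalType)
    (w : Y -> bool * bool * bool -> R) :
  (forall s, continuous (w ^~ s)) -> continuous (fun y => planeX (w y)).
Proof.
by move=> wc; apply: continuous_sub; [apply: continuous_sub;
  [apply: continuous_add|]|].
Qed.

Lemma continuous_planeY (Y : topologicalType)
    (w : Y -> bool * bool * bool -> R) :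
  (forall s, continuous (w ^~ s)) -> continuous (fun y => planeY (w y)).
Proof.
by move=> wc; apply: continuous_sub; [apply: continuous_sub;
  [apply: continuous_add|]|].
Qed.

Lemma continuous_hexagon (Y : topologicalType) (u v : Y -> R) s :
  continuous u -> continuous v -> continuous (fun y => hexagon s (u y) (v y)).
Proof.
move=> uc vc.
have c0 : continuous (fun _ : Y => 0 : R) by apply: cst_continuous.
have nu := continuous_opp uc; have nv := continuous_opp vc.
have uv := continuous_sub uc vc; have vu := continuous_sub vc uc.
by case: s => [[[] []] []] //=; do ?[apply: continuous_maxr => //;
  apply: continuous_minr => //].
Qed.

Lemma continuous_coord (v : V) : continuous (fun x : X => \val x v).
Proof.
move=> x; apply: (@continuous_comp _ _ _ (fun x : X => \val x)
  (fun f : prod_topology (fun _ : V => R) => f v)).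
  exact: continuous_val.
exact: continuous_proj.
Qed.

Lemma continuous_weight s : continuous (fun x : X => weight (\val x) s).
Proof. by apply: continuous_sumr => v; apply: continuous_coord. Qed.

Lemma continuous_to_circle i :
  continuous (fun x : X => to_circle (\val x) ord0 i).
Proof.
have Xc := continuous_planeX continuous_weight.
have Yc := continuous_planeY continuous_weight.
have -> : (fun x : X => to_circle (\val x) ord0 i) = fun x : X =>
    (if i == ord0 then planeX (weight (\val x)) else planeY (weight (\val x))) *
    (norm2 (planeX (weight (\val x))) (planeY (weight (\val x))))^-1.
  by apply/funext => x; rewrite mxE.
apply: continuous_mul; first by case: (i == ord0).
apply: continuous_inv => [x|].
  by apply/lt0r_neq0/norm2_gt0/plane_neq0/set_valP.
move=> x; apply: (@continuous_comp _ _ _ (fun x : X =>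
  planeX (weight (\val x)) ^+ 2 + planeY (weight (\val x)) ^+ 2) Num.sqrt).
  by apply: continuous_add; apply: continuous_mul.
exact: sqrt_continuous.
Qed.

Lemma continuous_of_circle (Y : topologicalType) (p : Y -> 'rV[R]_2) (v : V) :
  (forall y, unit_sphere R 2 (p y)) ->
  (forall i, continuous (fun y => p y ord0 i)) ->
  continuous (fun y => of_circle (p y) v : R).
Proof.
move=> pS pc; case: v => [s|i]; last exact: cst_continuous.
apply: continuous_mul; first exact: continuous_hexagon.
apply: continuous_inv => [y|].
  exact/lt0r_neq0/hexagon_sum_gt0/circle_neq0.
by apply: continuous_sumr => t; apply: continuous_hexagon.
Qed.

Definition circle_map (x : X) : S1 :=
  exist _ (to_circle (\val x)) (mem_set (to_circleP (set_valP x))).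

Definition hexagon_map (p : S1) : X :=
  exist _ (of_circle (\val p) : prod_topology (fun _ : V => R))
    (mem_set (of_circleP k (set_valP p))).

(** A homotopy is a total function on [R * X], so the parameter is forced into the unit interval. *)
Definition clamp (c : R) := Num.max 0 (Num.min 1 c).

Lemma clampP c : 0 <= clamp c <= 1.
Proof. by rewrite /clamp le_max lexx ge_max ler01 ge_min lexx. Qed.

Definition straight_homotopy (cx : R * X) : X :=
  exist _ ((fun v => (1 - clamp cx.1) * of_circle (to_circle (\val cx.2)) v +
            clamp cx.1 * \val cx.2 v) : prod_topology (fun _ : V => R))
    (mem_set (segmentP (set_valP cx.2) (clampP cx.1))).

Lemma continuous_circle_map : continuous circle_map.
Proof.
apply: continuous_set_type; apply: continuous_rV => i.
exact: continuous_to_circle.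
Qed.

Lemma continuous_hexagon_map : continuous hexagon_map.
Proof.
apply: continuous_set_type; apply: continuous_ptws => v.
apply: continuous_of_circle => [p|i p]; first exact: set_valP.
apply: (@continuous_comp _ _ _ (fun p : S1 => \val p)
  (fun M : 'rV[R]_2 => M ord0 i)).
  exact: continuous_val.
exact: coord_continuous.
Qed.

Lemma continuous_straight_homotopy : continuous straight_homotopy.
Proof.
have comp2 (g : X -> R) : continuous g -> continuous (fun cx : R * X => g cx.2).
  move=> gc cx; apply: (@continuous_comp _ _ _ (fun cx : R * X => cx.2) g).
    exact: cvg_snd.
  exact: gc.
have clampc : continuous (fun cx : R * X => clamp cx.1).
  apply: continuous_maxr; first exact: cst_continuous.
  apply: continuous_minr; first exact: cst_continuous.
  by move=> cx; apply: cvg_fst.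
apply: continuous_set_type; apply: continuous_ptws => v.
apply: continuous_add; apply: continuous_mul => //.
- by apply: continuous_sub => //; apply: cst_continuous.
- apply: (comp2 (fun x : X => of_circle (to_circle (\val x)) v)).
  apply: continuous_of_circle => [x|]; first exact/to_circleP/set_valP.
  exact: continuous_to_circle.
- by apply: (comp2 (fun x : X => \val x v)); apply: continuous_coord.
Qed.

Lemma stretched_cube_spherical : spherical R V.
Proof.
exists 2, circle_map, hexagon_map; split.
- exact: continuous_circle_map.
- exact: continuous_hexagon_map.
- exists straight_homotopy; split=> [|x|x].
  + exact/continuous_subspaceT/continuous_straight_homotopy.
  + apply: val_inj; apply/funext => v /=.
    have -> : clamp 0 = 0 by rewrite /clamp (min_idPr _) ?maxxx.
    by rewrite subr0 mul1r mul0r addr0.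
  + apply: val_inj; apply/funext => v /=.
    have -> : clamp 1 = 1 by rewrite /clamp minxx; apply/max_idPr.
    by rewrite subrr mul0r mul1r add0r.
(* Starting from the circle the composite is the identity, and the constant homotopy serves. *)
- exists snd; split=> [|p|//].
  + by apply: continuous_subspaceT => x; apply: cvg_snd.
  + by apply: val_inj => /=; rewrite of_circleK //; apply: set_valP.
Qed.

End Spherical.

Theorem theorem1p2 (R : realType) (n : nat) (hn : 9 <= n) :
  exists (d : Order.disp_t) (L : finTBLatticeType d),
    [/\ #|L| = n,
        congruence_uniform L,
        spherical R L
      & ~ is_lattice (@core_label_order d L)].
Proof.
(* There are [8 + k] elements, and [9 <= n] makes [k = n - 8] positive. *)
exists stretched_display, (stretched_cube (n - 8)); split.
- by rewrite card_stretched_cube subnKC // ltnW.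
- exact: stretched_cube_congruence_uniform.
- exact: stretched_cube_spherical.
- by apply: core_label_order_not_lattice; rewrite subn_gt0.
Qed.
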